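(* Let $S$ be either (i) a commutative semigroup whose universal semilattice is well-founded, or (ii) a solvable inverse semigroup whose semilattice of idempotents is well-founded. Then every nonprincipal strongly productive ultrafilter on $S$ is regular.
   Context: For a sequence $\vec{x}=(x_n)_{n\in\omega}$ in a semigroup $S$, $\mathrm{FP}(\vec{x})$ is the set of all products $\prod_{i\in a}x_i$ (in increasing order of indices), $a$ ranging over finite nonempty subsets of $\omega$, and $\mathrm{FP}_k(\vec{x})=\mathrm{FP}((x_{n+k})_{n\in\omega})$. An ultrafilter $p$ on $S$ is strongly productive if every $A\in p$ contains some $\mathrm{FP}(\vec{x})$ which belongs to $p$. A nonprincipal strongly productive ultrafilter $p$ is regular if there is $B\in p$ such that for every sequence $\vec{x}$ with $\mathrm{FP}(\vec{x})\subseteq B$, the set $x_0\mathrm{FP}_1(\vec{x})=\{x_0y: y\in\mathrm{FP}_1(\vec{x})\}$ does not belong to $p$. The universal semilattice of $S$ is the quotient by its smallest semilattice congruence; a semilattice is ordered by $x\le y$ iff $xy=x$, and is well-founded if every nonempty subset has a minimal element. Solvable inverse semigroups are in the sense of Piochi: class-$1$ solvable inverse semigroups are the commutative inverse semigroups, and one of class $n+1$ has a congruence $\gamma$ with $S/\gamma$ commutative such that $f^{-1}[E(S/\gamma)]$ (with $f$ the quotient map, $E(\cdot)$ the set of idempotents) is a solvable inverse subsemigroup of class $n$. *)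

(* Defs.v *)
From Stdlib Require Import List Sorted Arith Classical.
Set Implicit Arguments.
Import ListNotations.

Section Defs.
Context {A : Type}.
Variable op : A -> A -> A.

Definition associative_op : Prop := forall a b c, op (op a b) c = op a (op b c).
Definition commutative_op : Prop := forall a b, op a b = op b a.

Definition ultrafilter (p : (A -> Prop) -> Prop) : Prop :=
  ~ p (fun _ => False) /\
  p (fun _ => True) /\
  (forall X Y : A -> Prop, p X -> (forall y, X y -> Y y) -> p Y) /\
  (forall X Y : A -> Prop, p X -> p Y -> p (fun y => X y /\ Y y)) /\
  (forall X : A -> Prop, p X \/ p (fun y => ~ X y)).

Definition nonprincipal (p : (A -> Prop) -> Prop) : Prop :=
  forall x : A, ~ p (fun y => y = x).

(* product x_i * x_{j1} * ... * x_{jk} of the finite nonempty index set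
   {i < j1 < ... < jk}, taken in increasing order of indices *)
Definition prodl (x : nat -> A) (i : nat) (l : list nat) : A :=
  fold_left (fun acc j => op acc (x j)) l (x i).

(* FP(x): products over finite nonempty subsets of omega, encoded as
   strictly increasing nonempty lists i :: l *)
Definition FP (x : nat -> A) : A -> Prop :=
  fun y => exists (i : nat) (l : list nat),
    Sorted lt (i :: l) /\ y = prodl x i l.

Definition FPk (k : nat) (x : nat -> A) : A -> Prop :=
  FP (fun n => x (n + k)).

Definition subset (X Y : A -> Prop) : Prop := forall y, X y -> Y y.

Definition strongly_productive (p : (A -> Prop) -> Prop) : Prop :=
  forall X : A -> Prop, p X ->
    exists x : nat -> A, subset (FP x) X /\ p (FP x).

Definition regular_uf (p : (A -> Prop) -> Prop) : Prop :=
  nonprincipal p /\ strongly_productive p /\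
  exists B : A -> Prop, p B /\
    forall x : nat -> A, subset (FP x) B ->
      ~ p (fun y => exists z, FPk 1 x z /\ y = op (x 0) z).

Definition semilattice_congruence (R : A -> A -> Prop) : Prop :=
  (forall a, R a a) /\
  (forall a b, R a b -> R b a) /\
  (forall a b c, R a b -> R b c -> R a c) /\
  (forall a b c d, R a b -> R c d -> R (op a c) (op b d)) /\
  (forall a, R (op a a) a) /\
  (forall a b, R (op a b) (op b a)).

Definition univ_sl (a b : A) : Prop :=
  forall R, semilattice_congruence R -> R a b.

(* S / univ_sl is well-founded: every nonempty set of classes (= image of a
   nonempty P ⊆ S) has a minimal element w.r.t. [y] <= [m] iff [y m] = [y] *)
Definition univ_sl_wellfounded : Prop :=
  forall P : A -> Prop, (exists a, P a) ->
    exists m, P m /\ forall y, P y -> univ_sl (op y m) y -> univ_sl y m.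

Definition idempotent (e : A) : Prop := op e e = e.

Definition idempotents_wellfounded : Prop :=
  forall P : A -> Prop, (exists a, P a) -> (forall a, P a -> idempotent a) ->
    exists m, P m /\ forall y, P y -> op y m = y -> y = m.

Definition inverse_sub (T : A -> Prop) : Prop :=
  (forall a b, T a -> T b -> T (op a b)) /\
  (forall a, T a -> exists! b, T b /\ op (op a b) a = a /\ op (op b a) b = b).

Definition congruence_on (T : A -> Prop) (g : A -> A -> Prop) : Prop :=
  (forall a, T a -> g a a) /\
  (forall a b, T a -> T b -> g a b -> g b a) /\
  (forall a b c, T a -> T b -> T c -> g a b -> g b c -> g a c) /\
  (forall a b c d, T a -> T b -> T c -> T d -> g a b -> g c d ->
      g (op a c) (op b d)).

(* solvable inverse semigroups of class n (Piochi) on a subsemigroup T *)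
Fixpoint solvable_class (n : nat) (T : A -> Prop) : Prop :=
  match n with
  | O => False
  | 1 => inverse_sub T /\ (forall a b, T a -> T b -> op a b = op b a)
  | Datatypes.S m =>
      inverse_sub T /\
      exists g : A -> A -> Prop,
        congruence_on T g /\
        (forall a b, T a -> T b -> g (op a b) (op b a)) /\
        solvable_class m (fun s => T s /\ g (op s s) s)
  end.

Definition solvable_inverse : Prop :=
  exists n, solvable_class n (fun _ => True).

End Defs.

(* Main.v *)
(** Regularity of p follows from regularity of its image under any map that is a homomorphism on a
    set of p.  In case (ii), at each step of the solvable series either the image of p in the
    commutative quotient is nonprincipal, which leads to case (i), or p concentrates on the class of
    an idempotent and the class drops.  In case (i), well-foundedness makes p concentrate on one
    class of the universal semilattice, which is an archimedean semigroup.

    On a commutative archimedean semigroup, consider the characters to R/Z.  If some character is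
    not almost everywhere 0, then it tends to 0 along p, and the set where it is in (0, 1/4] (or in
    its opposite) is a witness of regularity.  Otherwise almost every element a satisfies one of the
    following.  Either some 2 chi(a) is nonzero: then, for a well-order of the characters, the
    witness is cut out by the sign of chi(a) for the first such chi.  Or all values chi(a) are
    2-torsion and not all are zero, in which case subset sums are linearly independent over F_2.
    Or every chi(a) is zero, hence ac = c for some c because characters separate the points of the
    maximal cancellative image, and then a is nilpotent modulo the minimal ideal. *)
From Stdlib Require Import List Sorted Arith Lia Reals Lra Classical.
From Stdlib Require Import ssreflect.
From mathcomp Require ssrbool boolp wochoice classical_sets.
Require Import Defs.
Import ListNotations.
Set Implicit Arguments.
Unset Strict Implicit.

(** * Finite products and images of ultrafilters *)

Definition regular_witness {S : Type} (op : S -> S -> S) (p : (S -> Prop) -> Prop) : Prop :=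
  exists B : S -> Prop, p B /\
    forall x : nat -> S, subset (FP op x) B ->
      ~ p (fun y => exists z, FPk op 1 x z /\ y = op (x 0) z).

Definition productive_uf {S : Type} (op : S -> S -> S) (p : (S -> Prop) -> Prop) : Prop :=
  ultrafilter p /\ nonprincipal p /\ strongly_productive op p.

(* The elements of [FP op x] whose indices are all less than [n]. *)
Fixpoint FPb {S : Type} (op : S -> S -> S) (x : nat -> S) (n : nat) (y : S) : Prop :=
  match n with
  | 0 => False
  | Datatypes.S m => FPb op x m y \/ y = x m \/ exists y', FPb op x m y' /\ y = op y' (x m)
  end.

Lemma FPb_mono {S : Type} (op : S -> S -> S) x n m y :
  n <= m -> FPb op x n y -> FPb op x m y.
Proof. by elim=> [//|k _ IH] H /=; left; apply: IH. Qed.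

Lemma Sorted_snoc l j : Sorted lt l -> (forall k, In k l -> k < j) -> Sorted lt (l ++ [j]).
Proof.
elim: l => [|a l IH] //= Hs Hj; first by repeat constructor.
inversion Hs as [|? ? Hl Ha]; subst.
constructor; first by apply: IH => // k Hk; apply: Hj; right.
case: l {IH Hs Hl} Ha Hj => [|b l] Ha Hj /=; constructor; first by apply: Hj; left.
by inversion Ha.
Qed.

Lemma prodl_FPb {S : Type} (op : S -> S -> S) x l i :
  StronglySorted lt (i :: l) -> forall n, (forall k, In k (i :: l) -> k < n) ->
  FPb op x n (prodl op x i l).
Proof.
elim/rev_ind: l => [|j l IH] Hs n Hn.
  apply: (@FPb_mono _ _ _ (Datatypes.S i)); first by apply: Hn; left.
  by right; left.
rewrite /prodl fold_left_app /=.
apply: (@FPb_mono _ _ _ (Datatypes.S j)).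
  by apply: Hn; right; apply/in_app_iff; right; left.
right; right; exists (prodl op x i l); split=> //.
have H : StronglySorted lt ((i :: l) ++ [j]) by [].
have Hj : forall k, In k (i :: l) -> k < j.
  move: H; elim: (i :: l) => [//|a l' IH'] /= H k Hk.
  inversion H as [|? ? H1 H2]; subst.
  case: Hk => [<-|Hk]; last exact: IH'.
  by move/Forall_forall: H2; apply; apply/in_app_iff; right; left.
apply: IH => //.
move: H; elim: (i :: l) => [|a l' IH'] /= H; first by constructor.
inversion H as [|? ? H1 H2]; subst; constructor; first exact: IH'.
by move/Forall_app: H2 => [].
Qed.

(** Replaces sorted index lists by a recursion on an index bound, so that later facts about [FP] go
    by induction on [n]. *)
Lemma FP_FPb {S : Type} (op : S -> S -> S) x y : FP op x y <-> exists n, FPb op x n y.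
Proof.
split.
  move=> [i [l [Hs ->]]].
  exists (Datatypes.S (list_max (i :: l))); apply: prodl_FPb.
    apply: Sorted_StronglySorted => //; exact: Nat.lt_trans.
  move=> k Hk; apply/Nat.lt_succ_r.
  have /list_max_le /Forall_forall : list_max (i :: l) <= list_max (i :: l) by [].
  by apply.
move=> [n Hn].
suff : exists i l, Sorted lt (i :: l) /\ y = prodl op x i l /\ forall k, In k (i :: l) -> k < n.
  by move=> [i [l [H1 [H2 _]]]]; exists i, l.
elim: n y Hn => [//|n IH] y /= [/IH|[->|[y' [/IH [i [l [H1 [-> H3]]]] ->]]]].
- by move=> [i [l [H1 [H2 H3]]]]; exists i, l; do 2 split=> //; move=> k /H3; lia.
- by exists n, []; split; [repeat constructor|split=> // k [<-|[]]].
exists i, (l ++ [n]); split; first exact: (@Sorted_snoc (i :: l)).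
split; first by rewrite /prodl fold_left_app.
by move=> k /(in_app_iff (i :: l)) [/H3|[<-|[]]]; lia.
Qed.

Lemma FP_elt {S : Type} (op : S -> S -> S) x i : FP op x (x i).
Proof. by exists i, []; split; repeat constructor. Qed.

Lemma FPk_FP {S : Type} (op : S -> S -> S) x y : FPk op 1 x y -> FP op x y.
Proof.
move=> /FP_FPb [n Hn]; apply/FP_FPb; exists (n + 1).
elim: n y Hn => [//|n IH] y /= [H|[->|[y' [H ->]]]]; first by left; exact: IH.
  by right; left.
by right; right; exists y'; split; first exact: IH.
Qed.

Lemma FP_head {S : Type} (op : S -> S -> S) x y :
  associative_op op -> FPk op 1 x y -> FP op x (op (x 0) y).
Proof.
move=> Ha /FP_FPb [n Hn]; apply/FP_FPb; exists (n + 1).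
elim: n y Hn => [//|n IH] y /= [H|[->|[y' [H ->]]]]; first by left; exact: IH.
  right; right; exists (x 0); split=> //.
  apply: (@FPb_mono _ _ _ 1); first by lia.
  by right; left.
by right; right; exists (op (x 0) y'); split; [exact: IH|rewrite Ha].
Qed.

Lemma FP_mul01 {S : Type} (op : S -> S -> S) x : FP op x (op (x 0) (x 1)).
Proof. by exists 0, [1]; split; repeat constructor. Qed.

(** Every partial product again lies in [FP op x], hence in [T], so [f] only has to be
    multiplicative on [T]. *)
Lemma FP_map {S Q : Type} (op : S -> S -> S) (opq : Q -> Q -> Q) (T : S -> Prop) (f : S -> Q)
    (x : nat -> S) :
  (forall a b, T a -> T b -> f (op a b) = opq (f a) (f b)) ->
  (forall y, FP op x y -> T y) ->
  forall z, FP opq (fun n => f (x n)) z <-> exists y, FP op x y /\ z = f y.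
Proof.
move=> Hf HT z.
suff H n w : FPb opq (fun i => f (x i)) n w <-> exists y, FPb op x n y /\ w = f y.
  split=> [/FP_FPb [n /H [y [Hy ->]]]|[y [/FP_FPb [n Hy] ->]]].
    by exists y; split=> //; apply/FP_FPb; exists n.
  by apply/FP_FPb; exists n; apply/H; exists y.
elim: n w => [|n IH] w /=; first by split=> [//|[y []]].
have Tx : T (x n) by apply: HT; exact: FP_elt.
split.
- move=> [/IH [y [Hy ->]]|[->|[w' [/IH [y [Hy ->]] ->]]]].
  + by exists y; split=> //; left.
  + by exists (x n); split=> //; right; left.
  + exists (op y (x n)); split; first by right; right; exists y.
    by rewrite Hf //; apply: HT; apply/FP_FPb; exists n.
- move=> [y [[Hy|[->|[y' [Hy ->]]]] ->]].
  + by left; apply/IH; exists y.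
  + by right; left.
  + right; right; exists (f y'); split; first by apply/IH; exists y'.
    by rewrite Hf //; apply: HT; apply/FP_FPb; exists n.
Qed.

Section Ultrafilter.
Context {S : Type} {p : (S -> Prop) -> Prop} (Hp : ultrafilter p).

Lemma uf_up (X Y : S -> Prop) : p X -> (forall y, X y -> Y y) -> p Y.
Proof. by case: Hp => _ [_ [H _]]; apply: H. Qed.

Lemma uf_and (X Y : S -> Prop) : p X -> p Y -> p (fun y => X y /\ Y y).
Proof. by case: Hp => _ [_ [_ [H _]]]; apply: H. Qed.

Lemma uf_all (X : S -> Prop) : (forall y, X y) -> p X.
Proof. by case: Hp => _ [H _] HX; apply: uf_up H _. Qed.

Lemma uf_not (X : S -> Prop) : ~ p X -> p (fun y => ~ X y).
Proof. by case: Hp => _ [_ [_ [_ H]]]; case: (H X). Qed.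

Lemma uf_ex (X : S -> Prop) : p X -> exists y, X y.
Proof.
move=> H; apply: NNPP => Hn; case: Hp => H0 _; apply: H0.
by apply: uf_up H _ => y Hy; apply: Hn; exists y.
Qed.

Lemma uf_or (X Y : S -> Prop) : p (fun y => X y \/ Y y) -> p X \/ p Y.
Proof.
move=> H; case: (classic (p X)) => [|/uf_not HX]; first by left.
by right; apply: uf_up (uf_and H HX) _ => y [[]].
Qed.

End Ultrafilter.

(** * Images of ultrafilters and quotient semigroups *)

Definition pushforward {S Q : Type} (f : S -> Q) (p : (S -> Prop) -> Prop) (X : Q -> Prop) :=
  p (fun a => X (f a)).

Lemma pushforward_uf {S Q : Type} (f : S -> Q) p :
  ultrafilter p -> ultrafilter (pushforward f p).
Proof.
move=> Hp; rewrite /pushforward; split; first by case: Hp.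
split; first by case: Hp => _ [].
split; first by move=> X Y HX HXY; apply: (@uf_up _ _ Hp _ _ HX) => y; exact: HXY.
split; first by move=> X Y HX HY; exact: (uf_and Hp).
by move=> X; case: Hp => _ [_ [_ [_ H]]]; exact: (H (fun a => X (f a))).
Qed.

Lemma pushforward_productive {S Q : Type} (op : S -> S -> S) (opq : Q -> Q -> Q)
    (T : S -> Prop) (f : S -> Q) p :
  ultrafilter p -> strongly_productive op p -> p T ->
  (forall a b, T a -> T b -> f (op a b) = opq (f a) (f b)) ->
  strongly_productive opq (pushforward f p).
Proof.
move=> Hp Hs HT Hf X HX.
have [x [Hx px]] := Hs _ (uf_and Hp HT HX).
have HxT y : FP op x y -> T y by move=> /Hx [].
exists (fun n => f (x n)); split.
  by move=> z /(FP_map Hf HxT) [y [/Hx [_ Hy] ->]].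
apply: (uf_up Hp px _) => y Hy; apply/(FP_map Hf HxT).
by exists y.
Qed.

(** The witness [B] is pulled back and cut down to [T], where [f] carries x_0 FP_1(x) into f(x_0)
    FP_1(f(x)). *)
Lemma pushforward_regular {S Q : Type} (op : S -> S -> S) (opq : Q -> Q -> Q)
    (T : S -> Prop) (f : S -> Q) p :
  associative_op op -> ultrafilter p -> p T ->
  (forall a b, T a -> T b -> f (op a b) = opq (f a) (f b)) ->
  regular_witness opq (pushforward f p) -> regular_witness op p.
Proof.
move=> Ha Hp HT Hf [B [HB Hreg]].
exists (fun a => T a /\ B (f a)); split; first exact: (uf_and Hp).
move=> x Hx Hpx.
have HxT y : FP op x y -> T y by move=> /Hx [].
have HxT1 y : FPk op 1 x y -> T y by move=> H; apply: HxT; exact: FPk_FP.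
apply: (Hreg (fun n => f (x n))).
  by move=> z /(FP_map Hf HxT) [y [/Hx [_ Hy] ->]].
apply: (uf_up Hp Hpx _) => y [z [Hz ->]].
exists (f z); split; last by apply: Hf; [apply: HxT; apply: FP_elt|exact: HxT1].
rewrite /FPk; apply/(FP_map Hf HxT1).
by exists z.
Qed.

(** Applied with equality as [g], this turns a subsemigroup given by a predicate into a type of its
    own. *)
Lemma quotient_exists {S : Type} (op : S -> S -> S) (T : S -> Prop) (g : S -> S -> Prop) :
  (exists a, T a) -> (forall a b, T a -> T b -> T (op a b)) -> congruence_on op T g ->
  exists (Q : Type) (opq : Q -> Q -> Q) (f : S -> Q),
    (forall a b, T a -> T b -> f (op a b) = opq (f a) (f b)) /\
    (forall a b, T a -> T b -> (f a = f b <-> g a b)) /\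
    (forall q, exists a, T a /\ f a = q).
Proof.
move=> [a0 Ta0] Tc [gr [gs [gt gm]]].
pose cls a := fun b => T b /\ g a b.
pose Q := {P : S -> Prop | exists a, T a /\ P = cls a}.
have clsE a b : T a -> T b -> (cls a = cls b <-> g a b).
  move=> Ta Tb; split=> [E|gab].
    have : cls b b by split=> //; exact: gr.
    by rewrite -E => -[].
  apply: boolp.funext => c; apply: boolp.propext.
  split=> -[Tc' H]; split=> //.
    by apply: (gt b a c) => //; apply: gs.
  by apply: (gt a b c).
have QE (P P' : Q) : proj1_sig P = proj1_sig P' -> P = P'.
  case: P P' => [P HP] [P' HP'] /= E; subst P'; f_equal; exact: boolp.Prop_irrelevance.
have [f Hf] : {f : S -> Q & forall a, T a -> proj1_sig (f a) = cls a}.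
  apply: (boolp.choice (P := fun a (q : Q) => T a -> proj1_sig q = cls a)) => a.
  case: (classic (T a)) => [Ta|nTa].
    by exists (exist _ (cls a) (ex_intro _ a (conj Ta eq_refl))).
  (* Outside [T] the value is an arbitrary default, the class of [a0]. *)
  by exists (exist _ (cls a0) (ex_intro _ a0 (conj Ta0 eq_refl))).
have fE a b : T a -> T b -> (f a = f b <-> g a b).
  move=> Ta Tb; rewrite -clsE // -!Hf //; split=> [->//|]; exact: QE.
have fsurj q : exists a, T a /\ f a = q.
  case: (proj2_sig q) => a [Ta Ea]; exists a; split=> //; apply: QE; by rewrite Hf.
have [r Hr] := boolp.choice fsurj.
exists Q, (fun q q' => f (op (r q) (r q'))), f; split=> //.
move=> a b Ta Tb.
have [Tra Ea] := Hr (f a); have [Trb Eb] := Hr (f b).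
apply/fE; try by apply: Tc.
by apply: gm => //; apply/fE.
Qed.

(** * Characters of commutative semigroups *)

Definition is_Z (r : R) : Prop := exists k : Z, r = IZR k.

Lemma is_Z_IZR k : is_Z (IZR k).
Proof. by exists k. Qed.

Lemma is_Z_add r s : is_Z r -> is_Z s -> is_Z (r + s)%R.
Proof. by move=> [k ->] [l ->]; exists (k + l)%Z; rewrite plus_IZR. Qed.

Lemma is_Z_opp r : is_Z r -> is_Z (- r)%R.
Proof. by move=> [k ->]; exists (- k)%Z; rewrite opp_IZR. Qed.

Lemma is_Z_sub r s : is_Z r -> is_Z s -> is_Z (r - s)%R.
Proof. by move=> Hr Hs; apply: is_Z_add => //; exact: is_Z_opp. Qed.

Ltac is_Z_from e :=
  match goal with |- is_Z ?r => replace r with e by (try lra; field; lra) end;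
  repeat first [assumption | apply: is_Z_IZR | apply: is_Z_sub | apply: is_Z_add | apply: is_Z_opp].

Lemma is_Z_between r : is_Z r -> (0 < r < 1)%R -> False.
Proof. by move=> [k ->] [/lt_IZR H0 /lt_IZR H1]; lia. Qed.

(** * Extension of characters to R/Z *)

Section MonoidCharacters.
Context {M : Type} (mul : M -> M -> M) (one : M).
Hypotheses (mulA : associative_op mul) (mulC : commutative_op mul) (mul1 : forall a, mul one a = a).

Fixpoint power (g : M) (n : nat) : M :=
  match n with 0 => one | Datatypes.S m => mul g (power g m) end.

Lemma mulCA a b c : mul a (mul b c) = mul b (mul a c).
Proof. by rewrite -!mulA (mulC a). Qed.

Ltac ac := rewrite ?mulA;
  repeat (try reflexivity;
    match goal with
    | |- mul ?x _ = mul ?x _ => f_equal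
    | |- mul ?x _ = ?r => match r with
        | context [mul ?y (mul x ?z)] => rewrite (mulCA y x z)
        | context [mul ?y x] => rewrite (mulC y x)
        end
    end).

Lemma powerD g n m : power g (n + m) = mul (power g n) (power g m).
Proof. by elim: n => [|n IH] /=; rewrite ?mul1 // IH mulA. Qed.

(* A partial character, as the graph of a homomorphism to R/Z from a submonoid of the
   universal group of [M]: [u] and [v] have the same image there iff [mul u c = mul v c] for some [c]. *)
Definition partial_character (G : M * R -> Prop) : Prop :=
  G (one, 0%R) /\
  (forall u r v s, G (u, r) -> G (v, s) -> G (mul u v, r + s)%R) /\
  (forall u r v s c, G (u, r) -> G (v, s) -> mul u c = mul v c -> is_Z (r - s)%R).

(* [tied G g k t]: [power g k] lies in the domain of [G] in the universal group, with value [t]. *)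
Definition tied (G : M * R -> Prop) (g : M) (k : nat) (t : R) : Prop :=
  exists u r v s c, G (u, r) /\ G (v, s) /\ t = (s - r)%R /\
    mul u (mul (power g k) c) = mul v c.

(* Divisibility of R/Z: with [d] the least positive exponent tied, at value [td], any [r] such that
   [d * r - td] is an integer is an admissible value at [g]; when [d] is not 1 one of
   [td / d] and [(td + 1) / d] is not an integer. *)
Lemma tied_value G g : partial_character G ->
  exists r, (forall k t, tied G g k t -> is_Z (INR k * r - t)%R) /\
    ((forall t, ~ tied G g 1 t) -> ~ is_Z r).
Proof.
move=> [G1 [Gm Gc]].
have tied0 t : tied G g 0 t -> is_Z t.
  move=> [u [r [v [s [c [Gu [Gv [-> E]]]]]]]].
  apply: (Gc _ _ _ _ c Gv Gu); by rewrite -E /= mul1.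
case: (classic (exists k t, tied G g (Datatypes.S k) t)) => [[k0 Hk0]|Hno]; last first.
  (* No positive exponent is tied, so every value is admissible at [g]; 1/2 is not an integer. *)
  exists (/ 2)%R; split=> [[|k] t Ht|_ HZ].
  - have Zt := tied0 _ Ht; rewrite /=; is_Z_from (- t)%R.
  - by case: Hno; exists k, t.
  - apply: (is_Z_between HZ); lra.
have [d [[td Htd] dmin]] : exists d, (exists t, tied G g (Datatypes.S d) t) /\
    forall k t, k < d -> ~ tied G g (Datatypes.S k) t.
  elim/(well_founded_ind lt_wf): k0 Hk0 => k IH Hk.
  case: (classic (exists j t, j < k /\ tied G g (Datatypes.S j) t)) => [[j [t [Hj Ht]]]|Hn].
    by apply: (IH j Hj); exists t.
  by exists k; split=> // j t Hj Ht; apply: Hn; exists j, t.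
have Hd0 : (0 < INR (Datatypes.S d))%R by apply: lt_0_INR; lia.
(* Euclidean descent: dividing a relation for a larger exponent by the one for the least exponent
   [d + 1] ties the difference of the exponents. *)
have tiedZ k t : tied G g k t -> forall r, is_Z (INR (Datatypes.S d) * r - td)%R -> is_Z (INR k * r - t)%R.
  move=> + r Hr; elim/(well_founded_ind lt_wf): k t => k IH t Ht.
  case: k IH Ht => [|k] IH Ht.
    have Zt := tied0 _ Ht; rewrite /=; is_Z_from (- t)%R.
  case: (Nat.lt_ge_cases k d) => Hkd; first by case: (dmin _ _ Hkd Ht).
  have Hk : k - d < Datatypes.S k by lia.
  have Zk : is_Z (INR (k - d) * r - (t - td))%R.
    apply: (IH _ Hk).
    case: Ht => [u [ru [v [sv [c [Gu [Gv [-> E]]]]]]]].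
    case: Htd => [u1 [ru1 [v1 [sv1 [c1 [Gu1 [Gv1 [-> E1]]]]]]]].
    exists (mul u v1), (ru + sv1)%R, (mul v u1), (sv + ru1)%R, (mul (power g (Datatypes.S d)) (mul c c1)).
    split; first exact: Gm; split; first exact: Gm; split; first lra.
    have -> : mul (mul v u1) (mul (power g (Datatypes.S d)) (mul c c1)) = mul (mul v c) (mul u1 (mul (power g (Datatypes.S d)) c1)).
      by move: (power _ _) => w; ac.
    rewrite E1 -E.
    have -> : Datatypes.S k = (k - d) + Datatypes.S d by lia.
    rewrite powerD; move: (power _ _) (power _ _) => w w'; by ac.
  have Ek : INR (Datatypes.S k) = (INR (k - d) + INR (Datatypes.S d))%R by rewrite -plus_INR; f_equal; lia.
  rewrite Ek; is_Z_from ((INR (k - d) * r - (t - td)) + (INR (Datatypes.S d) * r - td))%R.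
case: d Htd dmin Hd0 tiedZ => [|d] Htd dmin Hd0 tiedZ.
  (* Exponent 1 is tied: the value [td] is forced modulo 1 and the second clause is vacuous. *)
  exists td; split; last by move=> H; case: (H td).
  move=> k t Ht; apply: (tiedZ k t Ht).
  rewrite [INR 1]/=; is_Z_from (IZR 0).
pose D := INR (Datatypes.S (Datatypes.S d)).
have HD : (2 <= D)%R by rewrite /D !S_INR; have := pos_INR d; lra.
have H1 : is_Z (D * (td / D) - td)%R by is_Z_from (IZR 0).
have H2 : is_Z (D * ((td + 1) / D) - td)%R by is_Z_from (IZR 1).
(* The two candidates differ by 1/D with D at least 2, so they are not both integers. *)
case: (classic (is_Z (td / D)%R)) => HZ.
  exists ((td + 1) / D)%R; split=> [k t Ht|_ HZ']; first exact: (tiedZ k t Ht).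
  have : is_Z (/ D)%R by is_Z_from ((td + 1) / D - td / D)%R.
  move/is_Z_between; apply; split; first by apply: Rinv_0_lt_compat; lra.
  rewrite -Rinv_1; apply: Rinv_lt_contravar; lra.
exists (td / D)%R; split=> // k t Ht; exact: (tiedZ k t Ht).
Qed.

Definition adjoin (G : M * R -> Prop) (g : M) (r : R) (w : M * R) : Prop :=
  exists u t n, G (u, t) /\ w = (mul u (power g n), t + INR n * r)%R.

Lemma adjoin_incl G g r w : G w -> adjoin G g r w.
Proof.
case: w => u t Gw; exists u, t, 0; split=> //=.
by rewrite mulC mul1; f_equal; lra.
Qed.

Lemma adjoin_elt G g r : partial_character G -> adjoin G g r (g, r).
Proof.
move=> [G1 _]; exists one, 0%R, 1; split=> //=.
by rewrite mul1 mulC mul1; f_equal; lra.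
Qed.

(** An equality between elements with exponents [m <= n] ties [g] at exponent [n - m], where the
    choice of [r] makes the two values agree modulo 1. *)
Lemma adjoin_partial_character G g r : partial_character G ->
  (forall k t, tied G g k t -> is_Z (INR k * r - t)) -> partial_character (adjoin G g r).
Proof.
move=> [G1 [Gm Gc]] Hr; split; first exact: adjoin_incl.
split.
  move=> u t v s [u0 [t0 [n [Gu [-> ->]]]]] [v0 [s0 [m [Gv [-> ->]]]]].
  exists (mul u0 v0), (t0 + s0)%R, (n + m); split; first exact: Gm.
  f_equal; last by rewrite plus_INR; lra.
  by rewrite powerD; move: (power g n) (power g m) => w w'; ac.
have main u t n v s m c : G (u, t) -> G (v, s) -> m <= n ->
    mul (mul u (power g n)) c = mul (mul v (power g m)) c ->
    is_Z ((t + INR n * r) - (s + INR m * r)).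
  move=> Gu Gv Hmn E.
  have : tied G g (n - m) (s - t).
    exists u, t, v, s, (mul (power g m) c); do 3 split=> //.
    rewrite -[mul (power g (n - m)) _]mulA -powerD Nat.sub_add // -mulA E; exact: mulA.
  move/Hr; rewrite minus_INR // => HZ.
  by is_Z_from ((INR n - INR m) * r - (s - t))%R.
move=> _ _ _ _ c [u [t [n [Gu [-> ->]]]]] [v [s [m [Gv [-> ->]]]]] E.
case: (Nat.le_ge_cases m n) => H; first exact: (main _ _ _ _ _ _ c Gu Gv H E).
have HZ := main _ _ _ _ _ _ c Gv Gu H (eq_sym E).
by is_Z_from (- ((s + INR m * r) - (t + INR n * r)))%R.
Qed.

(** A homomorphism to R/Z, through an arbitrary real lift of each value. *)
Definition character (chi : M -> R) : Prop :=
  forall u v, is_Z (chi (mul u v) - chi u - chi v).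

(** Zorn's lemma gives a maximal partial character above [G0]; it is defined everywhere, since any
    missing [g] could be adjoined. *)
Lemma character_extension G0 : partial_character G0 ->
  exists chi, character chi /\ forall u r, G0 (u, r) -> is_Z (chi u - r).
Proof.
move=> HG0.
pose P G := (forall w, ~ G w) \/ (partial_character G /\ forall w, G0 w -> G w).
have [G [PG Gmax]] : exists G, P G /\ forall H, classical_sets.proper G H -> ~ P H.
  apply: classical_sets.Zorn_bigcup => F FP Ftot.
  case: (classic (exists G, F G /\ exists w, G w)) => [[G [FG [w Gw]]]|Hn]; last first.
    by left=> w [G FG Gw]; apply: Hn; exists G; split=> //; exists w.
  have pc H w' : F H -> H w' -> partial_character H /\ forall w, G0 w -> H w.
    by move=> FH Hw'; case: (FP _ FH) => // Hne; case: (Hne w').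
  have [[G1 _] G0G] := pc _ _ FG Gw.
  have join H1 H2 w1 w2 : F H1 -> F H2 -> H1 w1 -> H2 w2 ->
      exists H, F H /\ H w1 /\ H w2.
    move=> FH1 FH2 Hw1 Hw2.
    case: (Ftot _ _ FH1 FH2) => Hs.
      by exists H2; split=> //; split=> //; apply: Hs.
    by exists H1; split=> //; split=> //; apply: Hs.
  right; split; last by move=> w' /G0G Gw'; exists G.
  split; first by exists G.
  split.
    move=> u r v s [H1 FH1 Hu] [H2 FH2 Hv].
    have [H [FH [Hu' Hv']]] := join _ _ _ _ FH1 FH2 Hu Hv.
    have [[_ [Hm _]] _] := pc _ _ FH Hu'.
    by exists H => //; apply: Hm.
  move=> u r v s c [H1 FH1 Hu] [H2 FH2 Hv].
  have [H [FH [Hu' Hv']]] := join _ _ _ _ FH1 FH2 Hu Hv.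
  have [[_ [_ Hc]] _] := pc _ _ FH Hu'.
  exact: Hc.
have [Gpc G0G] : partial_character G /\ forall w, G0 w -> G w.
  case: PG => // Ge; case: (Gmax G0).
    split; first by move=> w /Ge.
    by case: HG0 => H1 _ /(_ _ H1) /Ge.
  by right.
have Gtot g : exists r, G (g, r).
  have [r [Hr _]] := tied_value g Gpc.
  exists r; apply: NNPP => Hn; apply: (Gmax (adjoin G g r)).
    split; first exact: adjoin_incl.
    by move=> /(_ _ (adjoin_elt g r Gpc)).
  right; split; first exact: adjoin_partial_character.
  by move=> w /G0G; exact: adjoin_incl.
have [chi Hchi] := boolp.choice Gtot.
case: (Gpc) => _ [Gm Gc].
exists chi; split.
  move=> u v.
  have HZ := Gc _ _ _ _ one (Hchi (mul u v)) (Gm _ _ _ _ (Hchi u) (Hchi v)) eq_refl.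
  by is_Z_from (chi (mul u v) - (chi u + chi v))%R.
move=> u r /G0G Gu; exact: (Gc _ _ _ _ one (Hchi u) Gu).
Qed.

(** As [a] fixes nothing, it is not tied at exponent 1 to the trivial submonoid, so the trivial
    character extends with a noninteger value at [a]. *)
Lemma character_separation a : (forall c, mul a c <> c) ->
  exists chi, character chi /\ ~ is_Z (chi a).
Proof.
move=> Ha.
pose G0 (w : M * R) := w = (one, 0%R).
have HG0 : partial_character G0.
  split=> //; split.
    by move=> u r v s [-> ->] [-> ->]; rewrite /G0 mul1; f_equal; lra.
  by move=> u r v s c [-> ->] [-> ->] _; is_Z_from (IZR 0).
have [r [Hr Hnr]] := tied_value a HG0.
have [chi [Hchi Hext]] := character_extension (adjoin_partial_character HG0 Hr).
exists chi; split=> // HZ; apply: Hnr.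
  move=> t [u [ru [v [sv [c [[-> _] [[-> _] [_]]]]]]]].
  by rewrite /= !mul1 [mul a one]mulC mul1 => /Ha.
have H := Hext _ _ (adjoin_elt a r HG0).
by is_Z_from (chi a - (chi a - r))%R.
Qed.

End MonoidCharacters.

Lemma semigroup_character_separation {S : Type} (op : S -> S -> S) a :
  associative_op op -> commutative_op op -> (forall c, op a c <> c) ->
  exists chi, character op chi /\ ~ is_Z (chi a).
Proof.
move=> opA opC Ha.
pose mul (x y : option S) := match x, y with
  | Some u, Some v => Some (op u v) | None, _ => y | _, None => x end.
have [chi [Hchi Hna]] : exists chi, character mul chi /\ ~ is_Z (chi (Some a)).
  apply: (@character_separation _ mul None).
  - by move=> [u|] [v|] [w|] //=; rewrite opA.
  - by move=> [u|] [v|] //=; rewrite opC.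
  - by [].
  - by move=> [c|] //= [] /Ha.
by exists (fun u => chi (Some u)); split=> // u v; exact: (Hchi (Some u) (Some v)).
Qed.

(** * Strongly productive ultrafilters and characters *)

(** Least elements are unique, so antisymmetry and transitivity follow from the least elements of
    sets of two and three elements. *)
Lemma well_order_exists (T : Type) : exists le : T -> T -> Prop,
  (forall x y z, le x y -> le y z -> le x z) /\
  (forall x y, le x y -> le y x -> x = y) /\
  forall A : T -> Prop, (exists x, A x) -> exists x, A x /\ forall y, A y -> le x y.
Proof.
have [R HR] := wochoice.well_ordering_principle (boolp.boolp_classicType__canonical__eqtype_Equality T).
pose le x y := is_true (R x y).
have lemin (A : T -> Prop) : (exists x, A x) -> exists z, (A z /\ forall y, A y -> le z y) /\
    forall w, A w -> (forall y, A y -> le w y) -> z = w.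
  move=> [x Ax].
  have Ex : wochoice.nonempty (fun y : boolp.classicType T => boolp.asbool (A y)).
    exists x; exact: (ssrbool.introT (boolp.asboolP (A x)) Ax).
  have [z [[Az Hz] Huniq]] := HR _ Ex.
  exists z; split.
    split; first exact: (ssrbool.elimT (boolp.asboolP (A z)) Az).
    by move=> y Ay; apply: Hz; exact: (ssrbool.introT (boolp.asboolP (A y)) Ay).
  move=> w Aw Hw; apply: Huniq; split; first exact: (ssrbool.introT (boolp.asboolP (A w)) Aw).
  by move=> y Ay; apply: Hw; exact: (ssrbool.elimT (boolp.asboolP (A y)) Ay).
have lerefl x : le x x.
  have [z [[-> Hz] _]] := lemin (eq x) (ex_intro _ x eq_refl); exact: Hz.
have leanti x y : le x y -> le y x -> x = y.
  move=> Hxy Hyx.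
  have [z [_ Hz]] := lemin (fun w => w = x \/ w = y) (ex_intro _ x (or_introl eq_refl)).
  have <- : z = x by apply: Hz; [left|move=> w [->|->]].
  by apply: Hz; [right|move=> w [->|->]].
exists le; split; last split=> //.
  move=> x y z Hxy Hyz.
  have [w [[Hw wmin] _]] := lemin (fun w => w = x \/ w = y \/ w = z) (ex_intro _ x (or_introl eq_refl)).
  case: Hw wmin => [->|[->|->]] wmin.
  - by apply: wmin; auto.
  - by rewrite (leanti x y) //; apply: wmin; auto.
  - have E : y = z by apply: leanti => //; apply: wmin; auto.
    by rewrite -E.
by move=> A /lemin [z [Hz _]]; exists z.
Qed.

Lemma character_opp {S : Type} (op : S -> S -> S) chi :
  character op chi -> character op (fun u => - chi u)%R.
Proof. move=> H u v /=; have Hc := H u v; is_Z_from (- (chi (op u v) - chi u - chi v))%R. Qed.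

Section Characters.
Context {S : Type} (op : S -> S -> S) (p : (S -> Prop) -> Prop).
Hypotheses (opA : associative_op op) (Hp : ultrafilter p)
  (Hs : strongly_productive op p).

Lemma productive_pair (X : S -> Prop) : p X -> exists a b, X a /\ X b /\ X (op a b).
Proof.
move=> /Hs [x [Hx _]]; exists (x 0), (x 1); split; first by apply: Hx; exact: FP_elt.
by split; apply: Hx; [exact: FP_elt|exact: FP_mul01].
Qed.

(* If chi took values in (e/2, e] modulo 1 almost everywhere, so would it on some a, b and ab. *)
Lemma character_halve chi e : character op chi -> (0 < e <= / 2)%R ->
  p (fun a => exists k, Rabs (chi a - IZR k) <= e)%R ->
  p (fun a => exists k, Rabs (chi a - IZR k) <= e / 2)%R.
Proof.
move=> Hchi He Hpe; apply: NNPP => /(uf_not Hp) Hpn.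
have no_pos phi : character op phi ->
    ~ p (fun a => exists k, e / 2 < phi a - IZR k <= e)%R.
  move=> Hphi /productive_pair [a [b [[k Hk] [[l Hl] [m Hm]]]]].
  have HZ := Hphi a b.
  have : is_Z (phi a - IZR k + (phi b - IZR l) - (phi (op a b) - IZR m)).
    by is_Z_from (IZR m - IZR k - IZR l - (phi (op a b) - phi a - phi b))%R.
  by move/is_Z_between; apply; lra.
have : p (fun a => (exists k, e / 2 < chi a - IZR k <= e) \/
                   exists k, e / 2 < - chi a - IZR k <= e)%R.
  apply: (uf_up Hp (uf_and Hp Hpe Hpn)) => a [[k Hk] Hnk].
  have Hk2 : ~ (Rabs (chi a - IZR k) <= e / 2)%R by move=> H; apply: Hnk; exists k.
  move: Hk Hk2; rewrite /Rabs; case: Rcase_abs => Hc Hk Hk2.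
    by right; exists (- k)%Z; rewrite opp_IZR; lra.
  by left; exists k; lra.
case/(uf_or Hp); first exact: no_pos.
exact: (no_pos _ (character_opp Hchi)).
Qed.

(** Starts from radius 1/2, where every real number has a nearby integer, and halves repeatedly. *)
Lemma character_converges chi e : character op chi -> (0 < e)%R ->
  p (fun a => exists k, Rabs (chi a - IZR k) <= e)%R.
Proof.
move=> Hchi He.
have H n : p (fun a => exists k, Rabs (chi a - IZR k) <= / 2 * / 2 ^ n)%R.
  elim: n => [|n IH].
    apply: (uf_all Hp) => a.
    have [H1 H2] := archimed (chi a).
    case: (Rle_lt_dec (IZR (up (chi a)) - chi a) (/ 2)) => H.
      by exists (up (chi a)); rewrite Rabs_left1 /=; lra.
    by exists (up (chi a) - 1)%Z; rewrite minus_IZR Rabs_right /=; lra.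
  have -> : (/ 2 * / 2 ^ Datatypes.S n = / 2 * / 2 ^ n / 2)%R.
    by rewrite /= Rinv_mult; lra.
  apply: character_halve => //.
  have H1 : (0 < 2 ^ n)%R by apply: pow_lt; lra.
  have H2 := Rinv_0_lt_compat _ H1.
  have H3 : (/ 2 ^ n <= 1)%R.
    rewrite -Rinv_1; apply: Rinv_le_contravar; first by lra.
    by apply: pow_R1_Rle; lra.
  lra.
have [n Hne] : exists n, (/ 2 ^ n < e)%R.
  have [n Hne] := pow_lt_1_zero (/ 2) (ltac:(rewrite Rabs_right; lra)) _ He.
  exists n; move: (Hne n (le_n n)); rewrite pow_inv; move=> H'.
  exact: (Rle_lt_trans _ _ _ (Rle_abs _) H').
apply: (uf_up Hp (H n)) => a [k Hk]; exists k.
have H1 : (0 < / 2 ^ n)%R by apply: Rinv_0_lt_compat; apply: pow_lt; lra.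
lra.
Qed.

(** The values at x_0 and y add up without wrapping round, so chi(x_0 y) stays further than half of
    chi(x_0) from 0 modulo 1, against convergence to 0 along [p]. *)
Lemma regular_of_positive_character chi : character op chi ->
  p (fun a => exists k, 0 < chi a - IZR k <= / 4)%R -> regular_witness op p.
Proof.
move=> Hchi HB; exists (fun a => exists k, 0 < chi a - IZR k <= / 4)%R; split=> // x Hx HZ.
have [k Hk] := Hx _ (FP_elt op x 0).
have He : (0 < (chi (x 0%nat) - IZR k) / 2)%R by lra.
have [_ [[y [Hy ->]] [l Hl]]] := uf_ex Hp (uf_and Hp HZ (character_converges Hchi He)).
have [m Hm] := Hx _ (FPk_FP Hy).
have HZ' := Hchi (x 0) y.
have : is_Z (chi (x 0) - IZR k + (chi y - IZR m) - (chi (op (x 0) y) - IZR l)).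
  by is_Z_from (IZR l - IZR k - IZR m - (chi (op (x 0%nat) y) - chi (x 0%nat) - chi y))%R.
by move/is_Z_between; apply; move: Hl; rewrite /Rabs; case: Rcase_abs; lra.
Qed.

Lemma regular_of_nontrivial_character chi : character op chi ->
  ~ p (fun a => is_Z (chi a)) -> regular_witness op p.
Proof.
move=> Hchi /(uf_not Hp) Hne.
have He : (0 < / 4)%R by lra.
have : p (fun a => (exists k, 0 < chi a - IZR k <= / 4) \/
                   exists k, 0 < - chi a - IZR k <= / 4)%R.
  apply: (uf_up Hp (uf_and Hp Hne (character_converges Hchi He))) => a [Ha [k]].
  have Hk : (chi a - IZR k <> 0)%R by move=> H; apply: Ha; exists k; lra.
  rewrite /Rabs; case: Rcase_abs => Hc Hk2.
    by right; exists (- k)%Z; rewrite opp_IZR; lra.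
  by left; exists k; lra.
case/(uf_or Hp); first exact: regular_of_positive_character.
exact: (regular_of_positive_character (character_opp Hchi)).
Qed.

(** * Characters that vanish along the ultrafilter *)

Hypothesis Htriv : forall chi, character op chi -> p (fun a => is_Z (chi a)).

(** The open half circle (0, 1/2) of R/Z; it and its opposite cover all but the 2-torsion. *)
Definition sgn_pos (r : R) : Prop := exists k, (0 < r - IZR k < / 2)%R.

Lemma sgn_pos_opp r s : sgn_pos r -> sgn_pos s -> ~ is_Z (r + s).
Proof.
move=> [k Hk] [l Hl] HZ.
have : is_Z (r + s - IZR k - IZR l) by is_Z_from (r + s - IZR k - IZR l)%R.
by move/is_Z_between; apply; lra.
Qed.

Lemma sgn_pos_dec r : ~ is_Z (2 * r) -> sgn_pos r \/ sgn_pos (- r).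
Proof.
move=> Hr.
have [H1 H2] := archimed r.
have N1 : (r <> IZR (up r))%R.
  by move=> E; apply: Hr; rewrite {}E; is_Z_from (IZR (up r) + IZR (up r))%R.
have N2 : (r - IZR (up r) + 1 <> / 2)%R.
  by move=> E; apply: Hr; is_Z_from (IZR (up r) + IZR (up r) - IZR 1)%R.
have N3 : (r - IZR (up r) + 1 <> 0)%R.
  by move=> E; apply: Hr; is_Z_from (IZR (up r) + IZR (up r) - IZR 1 - IZR 1)%R.
case: (Rlt_le_dec (IZR (up r) - r) (/ 2)) => H.
  by right; exists (- up r)%Z; rewrite opp_IZR; lra.
by left; exists (up r - 1)%Z; rewrite minus_IZR; lra.
Qed.

(* Almost every [z = x_0 y] is killed by 2 phi for all phi up to the first chi with
   2 chi(x_0) nonzero, so [y] has the same first character as [x_0], with the opposite value. *)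
Lemma regular_of_nontorsion_characters :
  p (fun a => exists chi, character op chi /\ ~ is_Z (2 * chi a)) -> regular_witness op p.
Proof.
move=> HN.
have [le [letr [leanti lemin]]] := well_order_exists (S -> R).
pose first a chi := character op chi /\ ~ is_Z (2 * chi a) /\
  forall phi, character op phi -> ~ is_Z (2 * phi a) -> le chi phi.
have firstE a : (exists chi, character op chi /\ ~ is_Z (2 * chi a)) -> exists chi, first a chi.
  move=> /(lemin (fun chi => character op chi /\ ~ is_Z (2 * chi a))) [chi [[H1 H2] H3]].
  by exists chi; split=> //; split=> // phi H4 H5; apply: H3.
(* [chi] is late when almost no [z] has its first character at or before [chi]. *)
pose late chi := ~ p (fun z => exists phi, first z phi /\ le phi chi).
(* Otherwise let [chi] be the least character that is not late and is first somewhere. Almost every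
   [z] has exactly [chi] as its first character, whereas chi(z) is almost always an integer. *)
have HB0 : p (fun a => exists chi, first a chi /\ late chi).
  apply: NNPP => /(uf_not Hp) Hno.
  have early : p (fun a => exists chi, first a chi /\ ~ late chi).
    apply: (uf_up Hp (uf_and Hp HN Hno)) => a [/firstE [chi Hchi] Ha].
    by exists chi; split=> // Hl; apply: Ha; exists chi.
  have [a [chi0 [Hchi0 /NNPP Hlate0]]] := uf_ex Hp early.
  have [chi [[[b Hb] Hchi] chimin]] :=
    lemin (fun chi => (exists a, first a chi) /\ p (fun z => exists phi, first z phi /\ le phi chi))
    (ex_intro _ chi0 (conj (ex_intro _ a Hchi0) Hlate0)).
  have Htriv' := Htriv (proj1 Hb).
  have [z [[[phi [Hphi /NNPP Hearly]] [psi [Hpsi Hle]]] Hz]] :=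
    uf_ex Hp (uf_and Hp (uf_and Hp early Hchi) Htriv').
  have E : phi = psi.
    case: (Hphi) (Hpsi) => [P1 [P2 P3]] [Q1 [Q2 Q3]].
    by apply: leanti; [apply: P3|apply: Q3].
  subst psi.
  have E : phi = chi by apply: leanti => //; apply: chimin; split=> //; exists z.
  by subst phi; case: Hpsi => _ [Hz2 _]; apply: Hz2; is_Z_from (chi z + chi z)%R.
have reg (sg : R) : (sg = 1 \/ sg = -1)%R ->
    p (fun a => exists chi, first a chi /\ late chi /\ sgn_pos (sg * chi a)) ->
    regular_witness op p.
  move=> Hsg HB.
  exists (fun a => exists chi, first a chi /\ late chi /\ sgn_pos (sg * chi a)); split=> // x Hx HZ.
  have [chi [Hfirst [Hlate Hpos]]] := Hx _ (FP_elt op x 0).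
  have [Hchi [Hchi2 Hchimin]] := Hfirst.
  have [_ [[[y [Hy ->]] Hz0] Hzlate]] :=
    uf_ex Hp (uf_and Hp (uf_and Hp HZ (Htriv Hchi)) (uf_not Hp Hlate)).
  have [psi [Hfirsty [_ Hposy]]] := Hx _ (FPk_FP Hy).
  have [Hpsi [Hpsi2 Hpsimin]] := Hfirsty.
  have zZ phi : character op phi -> le phi chi -> is_Z (2 * phi (op (x 0) y)).
    move=> Hphi Hle; apply: NNPP => HnZ; apply: Hzlate.
    have [rho Hrho] := firstE (op (x 0) y) (ex_intro _ phi (conj Hphi HnZ)).
    exists rho; split=> //; apply: (letr _ phi) => //.
    by case: Hrho => _ [_]; apply.
  have Hc := Hchi (x 0) y.
  (* Integrality of 2 chi(x_0) + 2 chi(y) puts [psi] at or before [chi]; since [chi] is late, 2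
     psi(x_0) + 2 psi(y) is then an integer too, which gives the converse. *)
  have E : psi = chi.
    have Hle : le psi chi.
      apply: Hpsimin => // HZy; apply: Hchi2.
      by is_Z_from (chi (op (x 0%nat) y) + chi (op (x 0%nat) y) - 2 * chi y - (chi (op (x 0%nat) y) - chi (x 0%nat) - chi y) - (chi (op (x 0%nat) y) - chi (x 0%nat) - chi y))%R.
    apply: leanti => //; apply: Hchimin => // HZx; apply: Hpsi2.
    have Hpz := zZ _ Hpsi Hle.
    have Hc' := Hpsi (x 0) y.
    by is_Z_from (2 * psi (op (x 0%nat) y) - 2 * psi (x 0%nat) - (psi (op (x 0%nat) y) - psi (x 0%nat) - psi y) - (psi (op (x 0%nat) y) - psi (x 0%nat) - psi y))%R.
  subst psi; apply: (sgn_pos_opp Hpos Hposy).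
  have HH : is_Z (chi (x 0) + chi y).
    by is_Z_from (chi (op (x 0%nat) y) - (chi (op (x 0%nat) y) - chi (x 0%nat) - chi y))%R.
  case: Hsg => ->; first by is_Z_from (chi (x 0%nat) + chi y)%R.
  by is_Z_from (- (chi (x 0%nat) + chi y))%R.
have : p (fun a => (exists chi, first a chi /\ late chi /\ sgn_pos (1 * chi a)) \/
                   exists chi, first a chi /\ late chi /\ sgn_pos (-1 * chi a)).
  apply: (uf_up Hp HB0) => a [chi [Hf Hl]].
  have [_ [H2 _]] := Hf.
  case: (sgn_pos_dec H2) => H; [left|right]; exists chi; do 2 split=> //.
    by rewrite Rmult_1_l.
  by have -> : (-1 * chi a = - chi a)%R by lra.
by case/(uf_or Hp); apply: reg; [left|right].
Qed.

(* If [x_0 y0 * x_0 y1 = x_0 y2] then, modulo 2-torsion, [x_0] is the sum of [y0], [y1], [y2], hence a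
   subsum of [x_1, x_2, ...], so that a product in [FP x] is killed by every character. *)
Lemma regular_of_torsion_characters :
  p (fun a => (forall chi, character op chi -> is_Z (2 * chi a)) /\
              exists chi, character op chi /\ ~ is_Z (chi a)) -> regular_witness op p.
Proof.
move=> HB; eexists; split; first exact: HB.
move=> x Hx HZ.
(* Elements are handled through their values on all characters modulo 1, where subset sums of the
   x_i can be added freely. *)
pose cong (v w : (S -> R) -> R) := forall chi, character op chi -> is_Z (v chi - w chi).
pose ev (a : S) (chi : S -> R) := chi a.
(* [span n v]: modulo 1, [v] is evaluation at a sum of some of x_1, ..., x_n, possibly the empty sum *)
pose span := fix span (n : nat) (v : (S -> R) -> R) : Prop := match n with
  | 0 => cong v (fun _ => 0%R)
  | Datatypes.S m => span m v \/ exists w, span m w /\ cong v (fun chi => w chi + chi (x (m + 1)%nat))%R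
  end.
have x2 n chi : character op chi -> is_Z (2 * chi (x n)).
  by move=> Hchi; case: (Hx _ (FP_elt op x n)) => H _; exact: H.
have span_cong n v w : cong v w -> span n w -> span n v.
  elim: n v w => [|n IH] v w Hvw /=.
    by move=> H chi Hchi; have := H _ Hchi; have := Hvw _ Hchi => H1 H2;
      is_Z_from ((v chi - w chi) + (w chi - 0))%R.
  move=> [H|[u [Hu H]]]; first by left; exact: IH H.
  right; exists u; split=> // chi Hchi; have H1 := H _ Hchi; have H2 := Hvw _ Hchi.
  by is_Z_from ((v chi - w chi) + (w chi - (u chi + chi (x (n + 1)%nat))))%R.
have spanD n v w : span n v -> span n w -> span n (fun chi => v chi + w chi)%R.
  elim: n v w => [|n IH] v w /=.
    move=> H1 H2 chi Hchi; have := H1 _ Hchi; have := H2 _ Hchi => H3 H4.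
    by is_Z_from ((v chi - 0) + (w chi - 0))%R.
  move=> [Hv|[v' [Hv Ev]]] [Hw|[w' [Hw Ew]]].
  - by left; exact: IH.
  - right; exists (fun chi => v chi + w' chi)%R; split; first exact: IH.
    move=> chi Hchi; have H := Ew _ Hchi.
    by is_Z_from (w chi - (w' chi + chi (x (n + 1)%nat)))%R.
  - right; exists (fun chi => v' chi + w chi)%R; split; first exact: IH.
    move=> chi Hchi; have H := Ev _ Hchi.
    by is_Z_from (v chi - (v' chi + chi (x (n + 1)%nat)))%R.
  (* The term x_{n+1} occurs twice and cancels by 2-torsion. *)
  - left; apply: span_cong (IH _ _ Hv Hw) => chi Hchi.
    have H1 := Ev _ Hchi; have H2 := Ew _ Hchi; have H3 := x2 (n + 1) _ Hchi.
    by is_Z_from ((v chi - (v' chi + chi (x (n + 1)%nat))) + (w chi - (w' chi + chi (x (n + 1)%nat))) + 2 * chi (x (n + 1)%nat))%R.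
have span_mono n m v : n <= m -> span n v -> span m v.
  by elim=> [//|k _ IH] H; left; exact: IH.
have FP_span n y : FPb op (fun i => x (i + 1)) n y -> span n (ev y).
  elim: n y => [//|n IH] y /= [H|[->|[y' [H ->]]]]; first by left; exact: IH.
    right; exists (fun _ => 0%R); split; last first.
      by move=> chi _; rewrite /ev; is_Z_from (IZR 0).
    apply: (span_mono 0); first by lia.
    by move=> chi _; is_Z_from (IZR 0).
  right; exists (ev y'); split; first exact: IH.
  move=> chi Hchi; rewrite /ev; have H1 := Hchi y' (x (n + 1)).
  by is_Z_from (chi (op y' (x (n + 1)%nat)) - chi y' - chi (x (n + 1)%nat))%R.
have span_FP n v : span n v -> cong v (fun _ => 0%R) \/
    exists y, FPb op (fun i => x (i + 1)) n y /\ cong v (ev y).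
  elim: n v => [|n IH] v /=; first by left.
  move=> [/IH [H|[y [Hy H]]]|[w [/IH [H|[y [Hy H]]] Ew]]].
  - by left.
  - by right; exists y; split=> //; left.
  - right; exists (x (n + 1)); split; first by right; left.
    move=> chi Hchi; rewrite /ev; have H1 := H _ Hchi; have H2 := Ew _ Hchi.
    by is_Z_from ((v chi - (w chi + chi (x (n + 1)%nat))) + (w chi - 0))%R.
  - right; exists (op y (x (n + 1))); split; first by right; right; exists y.
    move=> chi Hchi; have H1 := H _ Hchi; have H2 := Ew _ Hchi; rewrite /ev in H1 *.
    have H3 := Hchi y (x (n + 1)).
    by is_Z_from ((v chi - (w chi + chi (x (n + 1)%nat))) + (w chi - chi y) - (chi (op y (x (n + 1)%nat)) - chi y - chi (x (n + 1)%nat)))%R.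
have [_ [_ [[y0 [Hy0 ->]] [[y1 [Hy1 ->]] [y2 [Hy2 E]]]]]] := productive_pair HZ.
have Hsum chi : character op chi -> is_Z (chi (x 0) + (chi y0 + chi y1 + chi y2)).
  move=> Hchi.
  have H2 : is_Z (2 * chi y2) by case: (Hx _ (FPk_FP Hy2)) => H _; exact: H.
  have Ha := Hchi (x 0) y0; have Hb := Hchi (x 0) y1.
  have Hc := Hchi (op (x 0) y0) (op (x 0) y1).
  have Hd := Hchi (x 0) y2.
  rewrite -E in Hd.
  by is_Z_from ((chi (op (op (x 0%nat) y0) (op (x 0%nat) y1)) - chi (x 0%nat) - chi y2)
    - (chi (op (op (x 0%nat) y0) (op (x 0%nat) y1)) - chi (op (x 0%nat) y0) - chi (op (x 0%nat) y1))
    - (chi (op (x 0%nat) y0) - chi (x 0%nat) - chi y0) - (chi (op (x 0%nat) y1) - chi (x 0%nat) - chi y1)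
    + 2 * chi y2)%R.
move: (Hy0) (Hy1) (Hy2) => /FP_FPb [n0 H0] /FP_FPb [n1 H1] /FP_FPb [n2 H2].
pose n := n0 + n1 + n2.
have Hspan : span n (fun chi => ev y0 chi + ev y1 chi + ev y2 chi)%R.
  apply: (spanD); first apply: (spanD).
  - by apply: (span_mono n0); [rewrite /n; lia|exact: FP_span].
  - by apply: (span_mono n1); [rewrite /n; lia|exact: FP_span].
  - by apply: (span_mono n2); [rewrite /n; lia|exact: FP_span].
(* If the sum is empty, [x 0] itself is killed by every character; otherwise [op (x 0) y] is. *)
case: (span_FP _ _ Hspan) => [Hz|[y [Hy Hz]]].
  have [_ [chi [Hchi]]] := Hx _ (FP_elt op x 0); apply.
  have Ha := Hsum _ Hchi; have Hb := Hz _ Hchi; rewrite /ev in Hb.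
  by is_Z_from ((chi (x 0%nat) + (chi y0 + chi y1 + chi y2)) - (chi y0 + chi y1 + chi y2 - 0))%R.
have HyF : FPk op 1 x y by apply/FP_FPb; exists n.
have [_ [chi [Hchi]]] := Hx _ (FP_head opA HyF); apply.
have Ha := Hsum _ Hchi; have Hb := Hz _ Hchi; have Hc := Hchi (x 0) y; have Hd : is_Z (2 * chi y).
  by case: (Hx _ (FPk_FP HyF)) => H _; exact: H.
rewrite /ev in Hb.
by is_Z_from ((chi (op (x 0%nat) y) - chi (x 0%nat) - chi y) + (chi (x 0%nat) + (chi y0 + chi y1 + chi y2)) - (chi y0 + chi y1 + chi y2 - chi y))%R.
Qed.

End Characters.

(** * Archimedean, commutative and solvable inverse semigroups *)

(* [pow_succ op a n] is the power of exponent [n + 1]. *)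
Fixpoint pow_succ {S : Type} (op : S -> S -> S) (a : S) (n : nat) : S :=
  match n with 0 => a | Datatypes.S m => op a (pow_succ op a m) end.

Definition archimedean {S : Type} (op : S -> S -> S) : Prop :=
  forall a b, exists n s, pow_succ op a n = op b s.

Lemma opCA {S : Type} (op : S -> S -> S) : associative_op op -> commutative_op op ->
  forall a b c, op a (op b c) = op b (op a c).
Proof. by move=> opA opC a b c; rewrite -!opA (opC a). Qed.

Lemma opACA {S : Type} (op : S -> S -> S) : associative_op op -> commutative_op op ->
  forall a b c d, op (op a b) (op c d) = op (op a c) (op b d).
Proof. by move=> opA opC a b c d; rewrite !opA (opCA opA opC b). Qed.

(* All these [a] fix a common idempotent [e], and some power of [x_0] is [e], so long products in
   [FP w] collapse to [e] when [FP w] is included in [x_0 FP_1(x)]. *)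
Lemma regular_of_archimedean_unipotent {S : Type} (op : S -> S -> S) p :
  associative_op op -> commutative_op op -> archimedean op -> productive_uf op p ->
  p (fun a => exists c, op a c = c) -> regular_witness op p.
Proof.
move=> opA opC arch [Hp [Hn Hs]] HT.
have fix_pow a c n : op a c = c -> op (pow_succ op a n) c = c.
  by move=> E; elim: n => [//|n IH] /=; rewrite opA IH.
(* A fixed point [c] of [a] is divisible by every [b]: powers of [a] fix [c], and [b] divides one of
   them. *)
have fix_div a c b : op a c = c -> exists s, c = op b s.
  move=> E; have [n [s Es]] := arch a b.
  by exists (op s c); rewrite -opA -Es fix_pow.
have [a0 [c0 E0]] := uf_ex Hp HT.
have [t Et] := fix_div _ _ (op c0 c0) E0.
pose e := op c0 t.
have ee : op e e = e.
  by rewrite /e opA (opCA opA opC t) -opA -opA -Et.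
(* [e] is a multiple of [c], so whatever fixes [c] fixes [e]. *)
have eT a c : op a c = c -> op a e = e.
  move=> E; have [s Es] := fix_div _ _ c ee.
  by rewrite Es -opA E.
exists (fun a => op a e = e /\ a <> e); split.
  apply: (uf_and Hp); last exact: (uf_not Hp (Hn e)).
  by apply: (uf_up Hp HT) => a [c /eT].
move=> x Hx HZ.
have [x0e _] := Hx _ (FP_elt op x 0).
have [n En] : exists n, pow_succ op (x 0) n = e.
  have [n [s Es]] := arch (x 0) e; exists n.
  have H := fix_pow _ _ n x0e; rewrite Es in H *.
  by rewrite -[RHS]H opA (opC s) -opA ee.
have HB : p (fun a => (op a e = e /\ a <> e) /\ exists z, FPk op 1 x z /\ a = op (x 0) z).
  apply: (uf_and Hp) => //; apply: (uf_and Hp); last exact: (uf_not Hp (Hn e)).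
  by apply: (uf_up Hp HT) => a [c /eT].
have [w [Hw _]] := Hs _ HB.
(* Each w_i contributes a factor x_0, so w_0 ... w_m is x_0^(m+1) y with y fixing [e]. For m = n
   this is e y = e, which the witness excludes. *)
have prod m : exists y, op y e = e /\ FPb op w (Datatypes.S m) (op (pow_succ op (x 0) m) y).
  have wm k : exists z, op z e = e /\ w k = op (x 0) z.
    have [_ [z [Hz Ez]]] := Hw _ (FP_elt op w k).
    by exists z; split=> //; case: (Hx _ (FPk_FP Hz)).
  elim: m => [|m [y [Hy IH]]].
    by have [z [Hz Ez]] := wm 0; exists z; split=> //; right; left.
  have [z [Hz Ez]] := wm (Datatypes.S m).
  exists (op y z); split; first by rewrite opA Hz.
  right; right; exists (op (pow_succ op (x 0) m) y); split=> //.
  by rewrite Ez (opACA opA opC) /= (opC (pow_succ op (x 0) m)).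
have [y [Hy Hb]] := prod n.
have [[_ Hne] _] : (op (op (pow_succ op (x 0) n) y) e = e /\ op (pow_succ op (x 0) n) y <> e) /\ exists z, FPk op 1 x z /\ op (pow_succ op (x 0) n) y = op (x 0) z.
  by apply: Hw; apply/FP_FPb; exists (Datatypes.S n).
by apply: Hne; rewrite En opC.
Qed.

Lemma regular_of_archimedean {S : Type} (op : S -> S -> S) p :
  associative_op op -> commutative_op op -> archimedean op -> productive_uf op p ->
  regular_witness op p.
Proof.
move=> opA opC arch Hprod; have [Hp [Hn Hs]] := Hprod.
(* Without a witness every character vanishes almost everywhere, as the nontorsion case assumes. *)
apply: NNPP => Hnr.
have Htriv chi : character op chi -> p (fun a => is_Z (chi a)).
  move=> Hchi; apply: NNPP => H; apply: Hnr.
  exact: (regular_of_nontrivial_character Hp Hs Hchi H).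
apply: Hnr.
case: (classic (p (fun a => exists chi, character op chi /\ ~ is_Z (2 * chi a)))) => [|/(uf_not Hp) H1].
  exact: regular_of_nontorsion_characters.
case: (classic (p (fun a => exists chi, character op chi /\ ~ is_Z (chi a)))) => [H2|/(uf_not Hp) H2].
  apply: regular_of_torsion_characters => //.
  apply: (uf_up Hp (uf_and Hp H1 H2)) => a [Ha Ha']; split=> // chi Hchi.
  by apply: NNPP => HZ; apply: Ha; exists chi.
apply: regular_of_archimedean_unipotent => //.
apply: (uf_up Hp H2) => a Ha; apply: NNPP => Hc; apply: Ha.
by apply: semigroup_character_separation => // c E; apply: Hc; exists c.
Qed.

(** * The universal semilattice and the commutative case *)

Section UniversalSemilattice.
Context {S : Type} (op : S -> S -> S).

Lemma univ_sl_congruence : semilattice_congruence op (univ_sl op).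
Proof.
split; first by move=> a R [].
split; first by move=> a b H R HR; case: (HR) => _ [Hs _]; apply: Hs; exact: H.
split.
  move=> a b c H H' R HR; case: (HR) => _ [_ [Ht _]].
  by apply: (Ht a b c); [exact: H|exact: H'].
split.
  move=> a b c d H H' R HR; case: (HR) => _ [_ [_ [Hm _]]].
  by apply: Hm; [exact: H|exact: H'].
by split=> [a|a b] R [_ [_ [_ [_ []]]]].
Qed.

Hypotheses (opA : associative_op op) (opC : commutative_op op).

Lemma pow_succD a n m : op (pow_succ op a n) (pow_succ op a m) = pow_succ op a (Datatypes.S (n + m)).
Proof. by elim: n => [//|n IH] /=; rewrite opA IH. Qed.

Lemma pow_succ_mul a b n : pow_succ op (op a b) n = op (pow_succ op a n) (pow_succ op b n).
Proof. by elim: n => [//|n IH] /=; rewrite IH (opACA opA opC). Qed.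

Lemma pow_succ_iter a n m : exists k, pow_succ op (pow_succ op a n) m = pow_succ op a k.
Proof.
elim: m => [|m [k IH]] /=; first by exists n.
by rewrite IH pow_succD; eexists.
Qed.

(** Divisibility of powers in both directions is a semilattice congruence, so it contains the least
    one. *)
Lemma univ_sl_divides_power a b : univ_sl op a b -> exists n s, pow_succ op a n = op b s.
Proof.
pose dv a b := exists n s, pow_succ op a n = op b s.
have dvt u v w : dv u v -> dv v w -> dv u w.
  move=> [n [s Es]] [m [t Et]].
  have [k Ek] := pow_succ_iter u n m.
  exists k, (op t (pow_succ op s m)); by rewrite -Ek Es pow_succ_mul Et opA.
have dvm u v w z : dv u v -> dv w z -> dv (op u w) (op v z).
  move=> [n [s Es]] [m [t Et]].
  exists (Datatypes.S (n + m)), (op (op s t) (op (pow_succ op u m) (pow_succ op w n))).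
  rewrite pow_succ_mul -pow_succD Nat.add_comm -pow_succD Es Et.
  by rewrite (opACA opA opC (op v s)) (opACA opA opC v) opA.
move/(_ (fun a b => dv a b /\ dv b a)); case=> //.
split; first by move=> u; split; exists 1, u.
split; first by move=> u v [].
split; first by move=> u v w [H1 H2] [H3 H4]; split; [exact: dvt H3|exact: dvt H2].
split; first by move=> u v w z [H1 H2] [H3 H4]; split; exact: dvm.
split=> [u|u v]; split.
- by exists 0, u.
- by exists 2, u; rewrite /= opA.
- by exists 1, (op u v); rewrite /= [op v u]opC.
- by exists 1, (op v u); rewrite /= [op v u]opC.
Qed.

Lemma univ_sl_mul_class a b m : univ_sl op a m -> univ_sl op b m -> univ_sl op (op a b) m.
Proof.
have [_ [_ [slt [slm [sli _]]]]] := univ_sl_congruence.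
by move=> Ha Hb; apply: slt (sli m); exact: slm.
Qed.

Lemma univ_sl_mul_mul y a : univ_sl op (op (op y a) y) (op y a).
Proof.
have [slr [_ [_ [slm [sli _]]]]] := univ_sl_congruence.
by rewrite opC -opA; exact: slm.
Qed.

(** The quotient [s] may leave the class, but [s a] does not: it is congruent to [s b], a power of
    [a]. *)
Lemma univ_sl_class_archimedean m a b : univ_sl op a m -> univ_sl op b m ->
  exists n s, univ_sl op s m /\ pow_succ op a n = op b s.
Proof.
have [slr [sls [slt [slm [sli _]]]]] := univ_sl_congruence.
move=> Ha Hb.
have Hab : univ_sl op a b by apply: slt Ha _; exact: sls.
have [n [s Es]] := univ_sl_divides_power Hab.
have Hpow : univ_sl op (pow_succ op a n) m.
  by elim: (n) => [//|k IH] /=; exact: univ_sl_mul_class.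
exists (Datatypes.S n), (op s a); split; last by rewrite /= Es opC opA.
apply: slt Hpow; rewrite Es opC; exact: slm.
Qed.

(** If x_0 FP_1(x) belongs to [p], almost every y lies below x_0 in the semilattice. With [m]
    minimal among such bounds, the elements strictly below [m] form a witness unless [p]
    concentrates on the class of [m], which is archimedean. *)
Theorem regular_of_commutative p :
  univ_sl_wellfounded op -> productive_uf op p -> regular_witness op p.
Proof.
move=> wf [Hp [Hn Hs]].
have [slr [sls [slt [slm [sli slc]]]]] := univ_sl_congruence.
have below x : p (fun y => exists z, FPk op 1 x z /\ y = op (x 0) z) ->
    p (fun y => univ_sl op (op y (x 0)) y).
  by move=> H; apply: (uf_up Hp H) => _ [z [_ ->]]; exact: univ_sl_mul_mul.
case: (classic (exists e, p (fun y => univ_sl op (op y e) y))) => [Hex|Hno]; last first.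
  by exists (fun _ => True); split=> [|x _ /below H]; [exact: (uf_all Hp)|apply: Hno; exists (x 0)].
have [m [Hm mmin]] := wf _ Hex.
case: (classic (p (fun y => univ_sl op y m))) => [Hcl|/(uf_not Hp) Hcl]; last first.
  eexists; split; first exact: (uf_and Hp Hm Hcl).
  move=> x Hx /below H; case: (Hx _ (FP_elt op x 0)) => H1; apply.
  exact: mmin.
have eqc : congruence_on op (fun y => univ_sl op y m) eq.
  split=> //; split=> //; split; first by move=> a b c _ _ _ -> ->.
  by move=> a b c d _ _ _ _ -> ->.
have [Q [opq [f [fM [fE fsurj]]]]] :=
  @quotient_exists _ op (fun y => univ_sl op y m) eq (uf_ex Hp Hcl)
    (fun a b => @univ_sl_mul_class a b m) eqc.
apply: (pushforward_regular opA Hp Hcl fM).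
apply: regular_of_archimedean.
- move=> q1 q2 q3; have [a [Ha <-]] := fsurj q1; have [b [Hb <-]] := fsurj q2.
  have [c [Hc <-]] := fsurj q3.
  by rewrite -!fM ?opA //; exact: univ_sl_mul_class.
- move=> q1 q2; have [a [Ha <-]] := fsurj q1; have [b [Hb <-]] := fsurj q2.
  by rewrite -!fM ?[op a b]opC.
- move=> q1 q2; have [a [Ha <-]] := fsurj q1; have [b [Hb <-]] := fsurj q2.
  have [n [s [Hsm E]]] := univ_sl_class_archimedean Ha Hb.
  exists n, (f s); rewrite -fM // -E.
  have [//] : f (pow_succ op a n) = pow_succ opq (f a) n /\ univ_sl op (pow_succ op a n) m.
  elim: (n) => [//|k [IH1 IH2]] /=; split; last exact: univ_sl_mul_class.
  by rewrite fM // IH1.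
- split; first exact: pushforward_uf; split; last exact: (pushforward_productive Hp Hs Hcl fM).
  move=> q Hq; have [a [Ha Ea]] := fsurj q.
  apply: (Hn a); apply: (uf_up Hp (uf_and Hp Hcl Hq)) => y [Hy Eq].
  by apply/fE => //; rewrite Ea.
Qed.

End UniversalSemilattice.

(** * Inverse semigroups and the solvable series *)

Lemma univ_sl_regular_commutative {Q : Type} (op : Q -> Q -> Q) (a b s t : Q) :
  associative_op op -> commutative_op op ->
  a = op b s -> b = op a t -> univ_sl op a b.
Proof.
move=> opA opC Ea Eb R [Rr [Rs [Rt [Rm [Ri Rc]]]]].
(* u = v w lies below v: it is congruent to v v w = v u. *)
have main u v w : u = op v w -> R u (op v u).
  move=> ->; rewrite -opA; apply: Rm; last exact: Rr.
  exact: Rs.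
apply: (Rt _ _ _ (main _ _ _ Ea)); apply: (Rt _ (op a b)); first exact: Rc.
by apply: Rs; exact: main Eb.
Qed.

(** The commutative quotient is von Neumann regular, so each class of its universal semilattice
    contains the image of an idempotent of [T], and well-foundedness transfers from the
    idempotents. *)
Lemma inverse_quotient_step {S : Type} (op : S -> S -> S) p (T : S -> Prop) (g : S -> S -> Prop) :
  associative_op op -> idempotents_wellfounded op -> productive_uf op p -> p T ->
  inverse_sub op T -> congruence_on op T g ->
  (forall a b, T a -> T b -> g (op a b) (op b a)) ->
  regular_witness op p \/ exists e, T e /\ p (fun s => T s /\ g s e).
Proof.
move=> opA wf [Hp [Hn Hs]] HT [Tc Tinv] gc gcomm.
have [Q [opq [f [fM [fE fsurj]]]]] := quotient_exists (uf_ex Hp HT) Tc gc.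
have qA : associative_op opq.
  move=> q1 q2 q3; have [a [Ha <-]] := fsurj q1; have [b [Hb <-]] := fsurj q2.
  by have [c [Hc <-]] := fsurj q3; rewrite -!fM ?opA //; exact: Tc.
have qC : commutative_op opq.
  move=> q1 q2; have [a [Ha <-]] := fsurj q1; have [b [Hb <-]] := fsurj q2.
  by rewrite -!fM //; apply/fE; try apply: Tc; auto.
have inv a : T a -> exists b, T b /\ op (op a b) a = a.
  by move=> /Tinv [b [[Tb [E _]] _]]; exists b.
have qreg q : exists q', opq (opq q q') q = q.
  have [a [Ta <-]] := fsurj q; have [b [Tb E]] := inv _ Ta.
  by exists (f b); rewrite -!fM ?E //; exact: Tc.
have [slr [sls [slt [slm [sli slc]]]]] := univ_sl_congruence opq.
case: (classic (nonprincipal (pushforward f p))) => [Hn'|Hprin]; last first.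
  right; move: Hprin => /not_all_ex_not [q /NNPP Hq].
  have [e [Te Ee]] := fsurj q; exists e; split=> //.
  by apply: (uf_up Hp (uf_and Hp HT Hq)) => s [Ts Es]; split=> //; apply/fE => //; rewrite Ee.
left; apply: (pushforward_regular opA Hp HT fM).
apply: regular_of_commutative => //; last first.
  split; first exact: pushforward_uf; split=> //.
  exact: (pushforward_productive Hp Hs HT fM).
move=> P [q0 Pq0].
have idem_class q : exists e, T e /\ op e e = e /\ univ_sl opq (f e) q.
  have [a [Ta <-]] := fsurj q; have [b [Tb E]] := inv _ Ta.
  exists (op a b); split; first exact: Tc; split; first by rewrite -opA E.
  have Eq : opq (opq (f a) (f b)) (f a) = f a by rewrite -!fM ?E //; exact: Tc.
  rewrite fM //; apply: (@univ_sl_regular_commutative _ opq _ _ (f b) (f a)) => //.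
pose I e := T e /\ op e e = e /\ exists q, P q /\ univ_sl opq (f e) q.
have [e [[Te [ee [m [Pm Em]]]] emin]] : exists e, I e /\ forall y, I y -> op y e = y -> y = e.
  apply: wf; last by move=> e [_ []].
  by have [e [Te [ee Ee]]] := idem_class q0; exists e; do 2 split=> //; exists q0.
exists m; split=> // y Py Hym.
have [e' [Te' [ee' Ey]]] := idem_class y.
have Tu : T (op e' e) by exact: Tc.
have [v [Tv Ev]] := inv _ Tu.
(* An idempotent below [e] in the class of [e' e], which need not itself be idempotent. *)
pose k := op v (op e' e).
have Hky : univ_sl opq (f k) y.
  have Hu : univ_sl opq (f (op e' e)) y.
    by rewrite fM //; apply: slt Hym; exact: slm.
  apply: slt Hu.
  have Eq : opq (opq (f (op e' e)) (f v)) (f (op e' e)) = f (op e' e) by rewrite -!fM ?Ev //; exact: Tc.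
  rewrite /k fM //; apply: (@univ_sl_regular_commutative _ opq _ _ (f v) (f (op e' e))) => //.
  by rewrite [opq (f v) _]qC.
have Ek : k = e.
  apply: emin; last by rewrite /k !opA ee.
  split; first exact: Tc; split; last by exists y.
  by rewrite /k opA -[op (op e' e) _]opA Ev.
by apply: slt Em; apply: sls; rewrite -Ek.
Qed.

Lemma regular_of_solvable_class {S : Type} (op : S -> S -> S) p n (T : S -> Prop) :
  associative_op op -> idempotents_wellfounded op -> productive_uf op p ->
  solvable_class op n T -> p T -> regular_witness op p.
Proof.
move=> opA wf Hprod; have [Hp [Hn Hs]] := Hprod.
elim: n T => [//|[|n] IH] T.
  move=> [Tinv TC] HT.
  (* For class 1 the congruence is equality, and the second alternative would make [p] principal. *)
  have eqc : congruence_on op T eq.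
    split=> //; split; first by move=> a b _ _ ->.
    split; first by move=> a b c _ _ _ -> ->.
    by move=> a b c d _ _ _ _ -> ->.
  case: (inverse_quotient_step opA wf Hprod HT Tinv eqc TC) => // -[e [_ He]].
  by case: (Hn e); apply: (uf_up Hp He) => s [].
move=> [Tinv [g [gc [gC Hsol]]]] HT.
case: (inverse_quotient_step opA wf Hprod HT Tinv gc gC) => // -[e [Te He]].
apply: (IH _ Hsol); apply: (uf_up Hp He) => s [Ts Hse]; split=> //.
(* Productivity puts some a, b and ab in the class of [e], so this class is idempotent and lies in
   the next term of the series. *)
have [a [b [[Ta Ha] [[Tb Hb] [Tab Hab]]]]] := productive_pair Hs He.
have [Tc _] := Tinv; have [gr [gs [gt gm]]] := gc.
have See : g (op e e) e.
  apply: (gt _ (op a b)); try by [|apply: Tc].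
  by apply: gm => //; apply: gs.
apply: (gt _ (op e e)); try by [|apply: Tc].
  by apply: gm.
by apply: (gt _ e); try by [|apply: Tc|apply: gs].
Qed.

Theorem mainTheorem2 (S : Type) (op : S -> S -> S)
  (Hassoc : associative_op op)
  (Hcase : (commutative_op op /\ univ_sl_wellfounded op) \/
           (solvable_inverse op /\ idempotents_wellfounded op))
  (p : (S -> Prop) -> Prop) :
  ultrafilter p -> nonprincipal p -> strongly_productive op p ->
  regular_uf op p.
Proof.
move=> Hp Hn Hs; split=> //; split=> //.
case: Hcase => [[opC wf]|[[n Hsol] wf]]; first exact: regular_of_commutative.
by apply: (regular_of_solvable_class Hassoc wf _ Hsol); last exact: (uf_all Hp).
Qed.
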